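(* Let $R$ be a Noetherian ring, $M$ a finitely generated $R$-module, and $\{M_{\underline n}\mid \underline n\in\mathbb Z^t\}$ a Noetherian filtration of $M$. Then: (1) there exists $k\in\mathbb N$ such that for all $\underline m\in\mathbb Z^t$, all $\underline n\in\mathbb N^t$ and all ideals $J\subseteq R$, \[ J^{k|\underline n|}M_{\underline m}\cap\big(M_{\underline m+\underline n}:_{M_{\underline m}}J^{\infty}\big)\subseteq M_{\underline m+\underline n}, \] i.e. $\big(J^{k|\underline n|}M_{\underline m}+M_{\underline m+\underline n}\big)\cap\big(M_{\underline m+\underline n}:_{M_{\underline m}}J^{\infty}\big)=M_{\underline m+\underline n}$; (2) the set $\bigcup_{\underline m\in\mathbb Z^t,\ \underline n\in\mathbb N^t}\operatorname{Ass}(M_{\underline m}/M_{\underline m+\underline n})$ is finite.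
   Context: For $\underline n=(n_1,\dots,n_t)$, $|\underline n|=n_1+\cdots+n_t$ and $\mathbb N^t=\{\underline n: n_i\ge 0\}$. A family $\{M_{\underline n}\mid\underline n\in\mathbb Z^t\}$ of $R$-submodules of $M$ is a Noetherian filtration of $M$ if there is a $\mathbb Z^t$-graded subring $\mathcal R$ of $R[T_1,\dots,T_t,T_1^{-1},\dots,T_t^{-1}]$ (usual multigrading) containing $T_1^{-1},\dots,T_t^{-1}$ and whose degree-$(0,\dots,0)$ part is $R$, such that $\mathcal M=\bigoplus_{\underline n\in\mathbb Z^t}M_{\underline n}T_1^{n_1}\cdots T_t^{n_t}\subseteq M[T_1^{\pm1},\dots,T_t^{\pm1}]$ is an $\mathcal R$-submodule and is a Noetherian $\mathcal R$-module. For submodules $N\subseteq L$ and an ideal $J$, $(N:_L J^{\infty})=\bigcup_{i\ge0}\{x\in L: J^ix\subseteq N\}$. *)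

(* Defs.v *)
From HB Require Import structures.
From mathcomp Require Import all_boot all_order all_algebra.
Set Implicit Arguments. Unset Strict Implicit. Unset Printing Implicit Defensive.
Import Order.TTheory GRing.Theory Num.Theory.
Local Open Scope ring_scope.

Section Ideals.
Variable R : comPzRingType.

Definition is_ideal (I : R -> Prop) : Prop :=
  [/\ I 0, (forall a b, I a -> I b -> I (a + b)) & (forall r a, I a -> I (r * a))].

Definition is_prime_ideal (P : R -> Prop) : Prop :=
  [/\ is_ideal P, ~ P 1 & (forall a b, P (a * b) -> P a \/ P b)].

Definition noetherian_ring : Prop :=
  forall I : nat -> R -> Prop, (forall n, is_ideal (I n)) ->
    (forall n x, I n x -> I n.+1 x) ->
    exists N, forall n, (N <= n)%N -> forall x, I n x -> I N x.

Inductive prod_ideal (I J : R -> Prop) : R -> Prop :=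
| prod_gen a b : I a -> J b -> prod_ideal I J (a * b)
| prod_0 : prod_ideal I J 0
| prod_add x y : prod_ideal I J x -> prod_ideal I J y -> prod_ideal I J (x + y).

Fixpoint ideal_pow (J : R -> Prop) (k : nat) : R -> Prop :=
  match k with
  | 0 => fun _ => True
  | k'.+1 => prod_ideal J (ideal_pow J k')
  end.
End Ideals.

Section Modules.
Variables (R : comPzRingType) (M : lmodType R).

Definition is_submodule (N : M -> Prop) : Prop :=
  [/\ N 0, (forall x y, N x -> N y -> N (x + y)) & (forall r x, N x -> N (r *: x))].

Definition fin_gen : Prop :=
  exists (k : nat) (g : 'I_k -> M),
    forall x, exists c : 'I_k -> R, x = \sum_(i < k) c i *: g i.

Inductive ideal_mod (I : R -> Prop) (N : M -> Prop) : M -> Prop :=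
| im_gen a x : I a -> N x -> ideal_mod I N (a *: x)
| im_0 : ideal_mod I N 0
| im_add x y : ideal_mod I N x -> ideal_mod I N y -> ideal_mod I N (x + y).

Definition colon_inf (N L : M -> Prop) (J : R -> Prop) (x : M) : Prop :=
  L x /\ exists i : nat, forall a, ideal_pow J i a -> N (a *: x).

(* P \in Ass (L / N) for submodules N <= L of M:  P prime and P = ann (x + N)
   for some x in L. *)
Definition assoc_prime (P : R -> Prop) (L N : M -> Prop) : Prop :=
  is_prime_ideal P /\ exists x, L x /\ forall r, P r <-> N (r *: x).

Variable t : nat.
Notation Zt := 'rV[int]_t.

(* Elements of calM = (+)_n M_n T^n : finitely supported f with f n in M_n *)
Definition rees_mod_elt (F : Zt -> M -> Prop) (f : Zt -> M) : Prop :=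
  (exists s : seq Zt, forall a, a \notin s -> f a = 0) /\ forall a, F a (f a).

(* Elements of calR = (+)_n I_n T^n, written as finite sums of homogeneous
   terms r T^a (r in I_a), given by a list of pairs (a, r). *)
Definition rees_ring_elt (I : Zt -> R -> Prop) (g : seq (Zt * R)) : Prop :=
  forall p, p \in g -> I p.1 p.2.

Definition rees_act (g : seq (Zt * R)) (f : Zt -> M) : Zt -> M :=
  fun b => \sum_(p <- g) p.2 *: f (b - p.1).

Definition rees_submod (I : Zt -> R -> Prop) (F : Zt -> M -> Prop)
    (S : (Zt -> M) -> Prop) : Prop :=
  [/\ (forall f, S f -> rees_mod_elt F f),
      S (fun _ => 0),
      (forall f h, S f -> S h -> S (fun b => f b + h b)) &
      (forall g f, rees_ring_elt I g -> S f -> S (rees_act g f))].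

Definition rees_noetherian (I : Zt -> R -> Prop) (F : Zt -> M -> Prop) : Prop :=
  forall S : nat -> (Zt -> M) -> Prop, (forall n, rees_submod I F (S n)) ->
    (forall n f, S n f -> S n.+1 f) ->
    exists N, forall n, (N <= n)%N -> forall f, S n f -> S N f.

(* Noetherian filtration: the calR of the paper is (+)_a I_a T^a, where the
   homogeneous components I_a are ideals of R (R = degree-0 part lies in calR),
   I_0 = R, T_i^{-1} in calR, and calR is closed under products. *)
Definition noetherian_filtration (F : Zt -> M -> Prop) : Prop :=
  (forall a, is_submodule (F a)) /\
  exists I : Zt -> R -> Prop,
    [/\ (forall a, is_ideal (I a)),
        (forall r, I 0 r),
        (forall i : 'I_t, I (- delta_mx 0 i) 1),
        (forall a b r s, I a r -> I b s -> I (a + b) (r * s)) &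
        (forall a b r x, I a r -> F b x -> F (a + b) (r *: x))] /\
    rees_noetherian I F.
End Modules.

(* Main.v *)
Require Import Defs.
From HB Require Import structures.
From Stdlib Require Import Classical ClassicalEpsilon.
From mathcomp Require Import all_boot all_order all_algebra.
From mathcomp Require Import zify.
Set Implicit Arguments. Unset Strict Implicit. Unset Printing Implicit Defensive.
Import Order.TTheory GRing.Theory Num.Theory.
Local Open Scope ring_scope.

(** Everything happens inside [M], with families [N] of submodules indexed by
    degrees playing the role of graded submodules of the Rees module; Noetherianity
    of the Rees module is the ascending chain condition on such families.

    Starting from a graded submodule [N] and passing repeatedly to [(N : P)], with
    [P] a maximal annihilator of elements modulo [N], one reaches [F] after finitely
    many steps.  The ideals [P] met on the way for [N = F (_ + e_i)] contain all the
    associated primes, which gives (2) because each [F m / F (m + n)] is filtered by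
    quotients [F a / F (a + e_i)].

    For (1), replace [J] by the intersection [J'] of those [P] that contain it.  Then
    [(F (a + e_i) : J^oo) = (F (a + e_i) : J'^r)] with [r] fixed, and only finitely
    many ideals [J'] occur.  The Artin-Rees lemma for [J'] and this submodule gives
    [k] with [J'^(k + n) F a /\ (F (a + e_i) : J^oo)] inside [J'^n F (a + e_i)], and
    this is iterated along a path of [|n|] unit steps from [m] to [m + n]. *)

(** * Chain conditions and common bounds *)

(** Otherwise dependent choice builds a strictly ascending chain in [Q]. Maximality is expressed by
    [le] alone, so predicates are compared by inclusion. *)
Lemma acc_max (A : Type) (le : A -> A -> Prop) (C Q : A -> Prop) :
  (forall s : nat -> A, (forall n, C (s n)) -> (forall n, le (s n) (s n.+1)) ->
     exists N, forall n, (N <= n)%N -> le (s n) (s N)) ->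
  (forall a, Q a -> C a) -> (exists a, Q a) ->
  exists2 a, Q a & forall b, Q b -> le a b -> le b a.
Proof.
move=> acc QC [a0 Qa0]; apply: NNPP => nomax.
have next (u : {a | Q a}) : exists v : {a | Q a},
    le (sval u) (sval v) /\ ~ le (sval v) (sval u).
  apply: NNPP => nov; apply: nomax; exists (sval u); first exact: (svalP u).
  move=> b Qb lub; apply: NNPP => nlbu.
  by apply: nov; exists (exist _ b Qb).
pose nx u := sval (constructive_indefinite_description _ (next u)).
have nxP u : le (sval u) (sval (nx u)) /\ ~ le (sval (nx u)) (sval u).
  by rewrite /nx; case: constructive_indefinite_description.
pose s n := iter n nx (exist _ a0 Qa0).
have [n | n | N Nmax] := acc (fun n => sval (s n)).
- exact/QC/(svalP (s n)).
- exact: (nxP (s n)).1.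
- exact: (nxP (s N)).2 (Nmax N.+1 (leqnSn N)).
Qed.

(** Serves to merge the choices made for the finitely many directions or powers, with [maxn] on
    constants and [cat] on lists of ideals. *)
Lemma ord_bound (A : Type) (join : A -> A -> A) (a0 : A) (n : nat)
    (Phi : 'I_n -> A -> Prop) :
  (forall i a b, Phi i a -> Phi i (join a b)) ->
  (forall i a b, Phi i b -> Phi i (join a b)) ->
  (forall i, exists a, Phi i a) -> exists a, forall i, Phi i a.
Proof.
move=> joinl joinr ex.
have [a aP] : exists a, forall i, i \in enum 'I_n -> Phi i a.
  elim: (enum 'I_n) => [|i l [a aP]]; first by exists a0.
  have [b bP] := ex i; exists (join b a) => j.
  by rewrite inE => /orP [/eqP -> | /aP]; [apply: joinl | apply: joinr].
by exists a => i; apply: aP; rewrite mem_enum.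
Qed.

(** * Products and powers of ideals acting on submodules *)

Section IdealMod.
Variables (R : comPzRingType) (M : lmodType R).
Implicit Types (I J : R -> Prop) (N : M -> Prop).

Lemma submoduleB N x y : is_submodule N -> N x -> N y -> N (x - y).
Proof. by case=> _ ND NZ Nx Ny; apply: ND => //; rewrite -scaleN1r; apply: NZ. Qed.

Lemma submoduleZ N r x : is_submodule N -> N x -> N (r *: x).
Proof. by case=> _ _; apply. Qed.

Lemma ideal_mod_submodule I N : is_ideal I -> is_submodule (ideal_mod I N).
Proof.
case=> _ _ IM; split; [exact: im_0 | by move=> x y; apply: im_add |].
move=> r x; elim=> [a y Ia Ny||y z _ IHy _ IHz].
- by rewrite scalerA; apply: im_gen => //; apply: IM.
- by rewrite scaler0; apply: im_0.
- by rewrite scalerDr; apply: im_add.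
Qed.

Lemma ideal_mod_min I N K x : is_submodule K ->
  (forall a y, I a -> N y -> K (a *: y)) -> ideal_mod I N x -> K x.
Proof. by case=> K0 KD _ Kgen; elim=> // *; auto. Qed.

Lemma ideal_mod_scale I I' N N' r x :
  (forall a y, I a -> N y -> ideal_mod I' N' (r *: (a *: y))) ->
  ideal_mod I N x -> ideal_mod I' N' (r *: x).
Proof.
move=> H; elim=> [a y Ia Ny||y z _ IHy _ IHz]; first exact: H.
- by rewrite scaler0; apply: im_0.
- by rewrite scalerDr; apply: im_add.
Qed.

Lemma ideal_mod_shift I N N' r x : (forall y, N y -> N' (r *: y)) ->
  ideal_mod I N x -> ideal_mod I N' (r *: x).
Proof.
move=> H; apply: ideal_mod_scale => a y Ia Ny.
by rewrite scalerA mulrC -scalerA; apply: im_gen; auto.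
Qed.

Lemma ideal_mod_mono I I' N N' x : (forall a, I a -> I' a) ->
  (forall y, N y -> N' y) -> ideal_mod I N x -> ideal_mod I' N' x.
Proof.
move=> II' NN'; elim=> *; [apply: im_gen; auto | exact: im_0 | exact: im_add].
Qed.

Lemma ideal_mod_sub I N x : is_submodule N -> ideal_mod I N x -> N x.
Proof. by move=> sN; apply: (ideal_mod_min sN) => a y _; apply: submoduleZ. Qed.

Lemma ideal_pow_ideal J k : is_ideal J -> is_ideal (ideal_pow J k).
Proof.
case=> _ _ JM; case: k => [|k] //=; split; [exact: prod_0 | by move=> *; apply: prod_add |].
move=> r x; elim=> [a b Ja Jb||y z _ IHy _ IHz].
- by rewrite mulrA; apply: prod_gen => //; apply: JM.
- by rewrite mulr0; apply: prod_0.
- by rewrite mulrDr; apply: prod_add.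
Qed.

Lemma ideal_pow_mono I J k a : (forall a, I a -> J a) ->
  ideal_pow I k a -> ideal_pow J k a.
Proof.
move=> IJ; elim: k a => //= k IHk a.
elim=> *; [apply: prod_gen; auto | exact: prod_0 | exact: prod_add].
Qed.

Lemma ideal_pow_anti J k l a : is_ideal J -> (k <= l)%N ->
  ideal_pow J l a -> ideal_pow J k a.
Proof.
move=> idJ /subnK <-; elim: (l - k)%N a => //= m IHm a.
have [J0 JD JM] := ideal_pow_ideal k idJ.
by elim=> [b c _ Jc||*]; auto.
Qed.

Lemma ideal_pow_expr J k a : J a -> ideal_pow J k (a ^+ k).
Proof. by move=> Ja; elim: k => //= k IHk; rewrite exprS; apply: prod_gen. Qed.

Lemma ideal_mod_powS J N k b x : J b ->
  ideal_mod (ideal_pow J k) N x -> ideal_mod (ideal_pow J k.+1) N (b *: x).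
Proof.
move=> Jb; apply: ideal_mod_scale => a y Ja Ny.
by rewrite scalerA; apply: im_gen => //; apply: prod_gen.
Qed.

Lemma ideal_mod_pow_split J N p q x : is_ideal J ->
  ideal_mod (ideal_pow J (p + q)) N x ->
  ideal_mod (ideal_pow J p) (ideal_mod (ideal_pow J q) N) x.
Proof.
move=> idJ; apply: ideal_mod_min.
  exact/ideal_mod_submodule/ideal_pow_ideal.
elim: p => [|p IHp] a y Ja Ny.
  by rewrite -[a *: y]scale1r; apply: im_gen => //; apply: im_gen.
move: Ja; rewrite addSn /=; elim=> [b c Jb Jc||b c _ IHb _ IHc].
- by rewrite -scalerA; apply: ideal_mod_powS => //; apply: IHp.
- by rewrite scale0r; apply: im_0.
- by rewrite scalerDl; apply: im_add.
Qed.

Lemma ideal_mod_pow_join J N p q x : is_ideal J ->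
  ideal_mod (ideal_pow J p) (ideal_mod (ideal_pow J q) N) x ->
  ideal_mod (ideal_pow J (p + q)) N x.
Proof.
move=> idJ; apply: ideal_mod_min.
  exact/ideal_mod_submodule/ideal_pow_ideal.
elim: p => [|p IHp] a y Ja Ny.
  by apply: submoduleZ => //; apply/ideal_mod_submodule/ideal_pow_ideal.
move: Ja; rewrite addSn /=; elim=> [b c Jb Jc||b c _ IHb _ IHc].
- by rewrite -scalerA; apply: ideal_mod_powS => //; apply: IHp.
- by rewrite scale0r; apply: im_0.
- by rewrite scalerDl; apply: im_add.
Qed.

Definition generates (s : seq R) (J : R -> Prop) : Prop :=
  forall I, is_ideal I -> (forall g, g \in s -> I g) -> forall x, J x -> I x.

(** A maximal span of a finite subset of [J] absorbs every further element of [J]. *)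
Lemma ideal_fin_gen J : noetherian_ring R -> is_ideal J ->
  exists2 s : seq R, forall g, g \in s -> J g & generates s J.
Proof.
move=> noeth idJ.
pose span (s : seq R) x := forall I, is_ideal I -> (forall g, g \in s -> I g) -> I x.
have span_ideal s : is_ideal (span s).
  split=> [I [] //|a b Sa Sb I idI sI|r a Sa I idI sI]; have [_ ID IM] := idI.
  - by apply: ID; [apply: Sa | apply: Sb].
  - by apply: IM; apply: Sa.
pose Q I := exists2 s : seq R, forall g, g \in s -> J g & I = span s.
have [||S [s sJ defS] Smax] :=
  acc_max (Q := Q) (le := fun P P' : R -> Prop => forall r, P r -> P' r) noeth.
- by move=> I [s _ ->].
- by exists (span [::]); exists [::].
exists s => // I idI sI x Jx; have: span s x; last exact.
rewrite -defS; apply: (Smax (span (x :: s))).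
- exists (x :: s) => // g; rewrite inE => /orP [/eqP -> //|]; exact: sJ.
- rewrite defS => y Sy I' idI' sI'; apply: Sy => // g gs.
  by apply: sI'; rewrite inE gs orbT.
- by move=> I' _; apply; rewrite mem_head.
Qed.

End IdealMod.

(** * Graded submodules as families indexed by degrees *)

Section GradedFamilies.
Variables (R : comPzRingType) (M : lmodType R) (G : zmodType).
Implicit Types (I : G -> R -> Prop) (K S : G -> M -> Prop).

(** [I] is any set of homogeneous scalars, so adjoining generators to the ring of scalars only means
    enlarging [I]. *)
Definition graded_submodule I K : Prop :=
  (forall g, is_submodule (K g)) /\
  forall g h r x, I g r -> K h x -> K (g + h) (r *: x).

Definition family_le K S : Prop := forall g x, K g x -> S g x.

Definition graded_noetherian I K : Prop :=
  forall S : nat -> G -> M -> Prop,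
    (forall n, graded_submodule I (S n) /\ family_le (S n) K) ->
    (forall n, family_le (S n) (S n.+1)) ->
    exists N, forall n, (N <= n)%N -> family_le (S n) (S N).

(** * Hilbert basis theorem for one adjoined homogeneous scalar *)

Section HilbertBasis.
Variables (I I' : G -> R -> Prop) (K : G -> M -> Prop) (beta : G) (a : R).
Hypotheses (II' : forall g r, I g r -> I' g r) (I'a : I' beta a).
Hypothesis I'_inv : forall g r, I' g r -> I g r \/ g = beta /\ r = a.
Hypotheses (subK : graded_submodule I K) (noethK : graded_noetherian I K).

(* [poly_lt d g] is the degree-[g] part of the sums of [a ^+ j *: K], [j < d]. *)
Fixpoint poly_lt (d : nat) (g : G) (x : M) : Prop :=
  if d is d'.+1 then
    exists y k, [/\ poly_lt d' g y, K (g - beta *+ d') k & x = y + a ^+ d' *: k]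
  else x = 0.

Definition poly_family (g : G) (x : M) : Prop := exists d, poly_lt d g x.

Lemma poly_lt_graded d : graded_submodule I (poly_lt d).
Proof.
have [sK IK] := subK.
elim: d => [|d [IHs IHI]] /=.
  by split=> [g|g h r x _ ->]; [split=> // [x y -> ->|r x ->] |];
    rewrite ?addr0 ?scaler0.
split=> [g|g h r _ Ir [y [k [Py Kk ->]]]].
  have [P0 PD PZ] := IHs g; have [K0 KD KZ] := sK (g - beta *+ d).
  split.
  - by exists 0, 0; split; rewrite ?scaler0 ?addr0.
  - move=> _ _ [y [k [Py Kk ->]]] [z [l [Pz Kl ->]]].
    exists (y + z), (k + l); split; auto.
    by rewrite scalerDr addrACA.
  - move=> r _ [y [k [Py Kk ->]]]; exists (r *: y), (r *: k); split; auto.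
    by rewrite scalerDr !scalerA mulrC.
exists (r *: y), (r *: k); split.
- exact: IHI.
- by rewrite -addrA; apply: IK.
- by rewrite scalerDr !scalerA mulrC.
Qed.

Lemma poly_ltS d g x : poly_lt d g x -> poly_lt d.+1 g x.
Proof.
by move=> Px; exists x, 0; split; rewrite ?scaler0 ?addr0 //; case: (subK.1 (g - beta *+ d)).
Qed.

Lemma poly_lt_le d e g x : (d <= e)%N -> poly_lt d g x -> poly_lt e g x.
Proof. by move=> /subnK <- Px; elim: (e - d)%N => //= n IHn; apply: poly_ltS. Qed.

Lemma poly_lt_mulX d g x : poly_lt d g x -> poly_lt d.+1 (beta + g) (a *: x).
Proof.
elim: d g x => [|d IHd] g x /=.
  move=> ->; exists 0, 0; rewrite !scaler0 addr0; split=> //.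
  by case: (subK.1 (beta + g - beta *+ 0)).
move=> [y [k [/IHd Py Kk ->]]]; exists (a *: y), k; split=> //.
- by rewrite mulrS [beta + g]addrC addrKA.
- by rewrite scalerDr scalerA -exprS.
Qed.

Lemma poly_family_graded : graded_submodule I' poly_family.
Proof.
split=> [g|g h r x I'r [d Px]].
  split; first by exists 0%N.
    move=> x y [d Px] [e Py]; exists (maxn d e).
    have [_ PD _] := (poly_lt_graded (maxn d e)).1 g.
    by apply: PD; [apply: poly_lt_le Px | apply: poly_lt_le Py];
      rewrite ?leq_maxl ?leq_maxr.
  by move=> r x [d Px]; exists d; apply: submoduleZ Px; case: (poly_lt_graded d).
have [Ir|[-> ->]] := I'_inv I'r.
  by exists d; apply: (poly_lt_graded d).2.
by exists d.+1; apply: poly_lt_mulX.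
Qed.

Lemma family_le_poly : family_le K poly_family.
Proof.
move=> g x Kx; exists 1%N => /=; exists 0, x.
by rewrite mulr0n subr0 add0r scale1r.
Qed.

(** The leading coefficients of elements of [S] written with [a]-degree at most [d]. Such a writing
    need not be unique inside [M], and every one of them counts. *)
Definition lead_coefs (d : nat) S (h : G) (k : M) : Prop :=
  K h k /\ exists y, poly_lt d (h + beta *+ d) y /\
    S (h + beta *+ d) (y + a ^+ d *: k).

Lemma lead_coefs_graded d S : graded_submodule I' S ->
  graded_submodule I (lead_coefs d S).
Proof.
move=> [sS IS]; have [sK IK] := subK; have [sP IP] := poly_lt_graded d.
split=> [h|g h r k Ir [Kk [y [Py Sy]]]].
  have [K0 KD KZ] := sK h; have [P0 PD PZ] := sP (h + beta *+ d).
  have [S0 SD SZ] := sS (h + beta *+ d).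
  split.
  - by split=> //; exists 0; rewrite scaler0 addr0.
  - move=> k l [Kk [y [Py Sy]]] [Kl [z [Pz Sz]]]; split; first exact: KD.
    by exists (y + z); split; [apply: PD | rewrite scalerDr addrACA; apply: SD].
  - move=> r k [Kk [y [Py Sy]]]; split; first exact: KZ.
    exists (r *: y); split; first exact: PZ.
    by rewrite scalerA mulrC -scalerA -scalerDr; apply: SZ.
split; first exact: IK.
exists (r *: y); rewrite -addrA; split; first exact: IP.
by rewrite scalerA mulrC -scalerA -scalerDr; apply: IS => //; apply: II'.
Qed.

Lemma lead_coefsS d S : graded_submodule I' S ->
  family_le (lead_coefs d S) (lead_coefs d.+1 S).
Proof.
move=> [sS IS] h k [Kk [y [Py Sy]]]; split=> //; exists (a *: y).
rewrite mulrS addrCA; split; first exact: poly_lt_mulX.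
by rewrite exprS -scalerA -scalerDr; apply: IS.
Qed.

Lemma lead_coefs_le d e S : (d <= e)%N -> graded_submodule I' S ->
  family_le (lead_coefs d S) (lead_coefs e S).
Proof.
move=> /subnK <- gS; elim: (e - d)%N => [|n IHn] g x Lx //.
exact/lead_coefsS/IHn.
Qed.

Lemma lead_coefs_mono d S S' : family_le S S' ->
  family_le (lead_coefs d S) (lead_coefs d S').
Proof. by move=> SS' h k [Kk [y [Py Sy]]]; split=> //; exists y; auto. Qed.

(** Induction on the [a]-degree: subtracting an element of [S] with the same leading coefficient
    lowers the degree. *)
Lemma lead_coefs_inj S S' : graded_submodule I' S -> graded_submodule I' S' ->
  family_le S S' -> family_le S' poly_family ->
  (forall d, family_le (lead_coefs d S') (lead_coefs d S)) -> family_le S' S.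
Proof.
move=> [sS _] [sS' _] SS' S'P LS g x S'x.
have [d Px] := S'P _ _ S'x; elim: d x Px S'x => [|d IHd] x /=.
  by move=> -> _; case: (sS g).
move=> [y [k [Py Kk ->]]] S'x.
have Egd : g - beta *+ d + beta *+ d = g by rewrite subrK.
have /LS[_ [z]] : lead_coefs d S' (g - beta *+ d) k.
  by split=> //; exists y; rewrite Egd.
rewrite Egd => -[Pz Sz].
have -> : y + a ^+ d *: k = (y - z) + (z + a ^+ d *: k) by rewrite addrA subrK.
have [_ SD _] := sS g; apply: SD => //; apply: IHd.
  by apply: submoduleB => //; case: (poly_lt_graded d).
have -> : y - z = (y + a ^+ d *: k) - (z + a ^+ d *: k) by rewrite [z + _]addrC addrKA.
by apply: submoduleB => //; apply: SS'.
Qed.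

(** Leading coefficients grow both with [d] and with the chain index. The diagonal chain stabilises
    at some [N], and each of the finitely many rows [d < N] stabilises too. *)
Lemma hilbert_basis : graded_noetherian I' poly_family.
Proof.
move=> S SP Sinc.
have Smono m n : (m <= n)%N -> family_le (S m) (S n).
  by move=> /subnK <- g x Sx; elim: (n - m)%N => //= p IHp; apply: Sinc.
have gS n := (SP n).1.
have LP d n : graded_submodule I (lead_coefs d (S n)) /\
    family_le (lead_coefs d (S n)) K.
  by split; [apply: lead_coefs_graded | move=> h k []].
have [n|N diagN] := noethK (fun n => LP n n).
  by move=> g x Lx; apply: lead_coefsS => //; apply: lead_coefs_mono Lx; apply: Sinc.
have [N' lowN] : exists N', forall d : 'I_N, forall n, (N' <= n)%N ->
    family_le (lead_coefs d (S n)) (lead_coefs d (S N')).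
  apply: (ord_bound (join := maxn) 0%N) => [d p q dp n|d p q dq n|d].
  - move=> le_n g x Lx; apply: (lead_coefs_mono (Smono _ _ (leq_maxl p q))).
    by apply: (dp n) => //; apply: leq_trans le_n; apply: leq_maxl.
  - move=> le_n g x Lx; apply: (lead_coefs_mono (Smono _ _ (leq_maxr p q))).
    by apply: (dq n) => //; apply: leq_trans le_n; apply: leq_maxr.
  - by apply: (noethK (LP d)) => n; apply: lead_coefs_mono; apply: Sinc.
exists (maxn N N') => n le_n.
apply: lead_coefs_inj => //; [exact: Smono | exact: (SP n).2 |].
move=> d h k Lk; have [ltdN|leNd] := ltnP d N.
  apply: (lead_coefs_mono (Smono _ _ (leq_maxr N N'))).
  apply: (lowN (Ordinal ltdN) n) => //.
  by apply: leq_trans le_n; apply: leq_maxr.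
(* For [d >= N], pass up to the diagonal at [maxn d n], down to [N] by stability, then up again to
   row [d]. *)
apply: (lead_coefs_mono (Smono _ _ (leq_maxl N N'))).
apply: (@lead_coefs_le N) => //.
apply: (diagN (maxn d n)); first by rewrite leq_max leNd.
apply: (@lead_coefs_le d); rewrite ?leq_maxl //.
by apply: lead_coefs_mono Lk; apply: Smono; rewrite leq_maxr.
Qed.

End HilbertBasis.

Definition adjoin I (beta : G) (s : seq R) (g : G) (r : R) : Prop :=
  I g r \/ g = beta /\ r \in s.

(** The elements of [s] are adjoined one at a time, each by the Hilbert basis argument. *)
Lemma adjoin_noetherian I K beta s :
  graded_submodule I K -> graded_noetherian I K ->
  exists K', [/\ family_le K K', graded_submodule (adjoin I beta s) K' &
    graded_noetherian (adjoin I beta s) K'].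
Proof.
move=> gK noethK; elim: s => [|a s [K' [KK' gK' noethK']]].
  have I0 g r : adjoin I beta [::] g r -> I g r by case=> // -[].
  exists K; split=> //; first by split=> [|g h r x /I0]; apply gK.
  move=> S SP; apply: noethK => n; have [[sS IS] SK] := SP n.
  by split=> //; split=> // g h r x Ir; apply: IS; left.
exists (poly_family K' beta a).
have inc g r : adjoin I beta s g r -> adjoin I beta (a :: s) g r.
  by case=> [|[-> rs]]; [left | right; rewrite inE rs orbT].
have adj_a : adjoin I beta (a :: s) beta a by right; rewrite mem_head.
have inv g r : adjoin I beta (a :: s) g r ->
    adjoin I beta s g r \/ g = beta /\ r = a.
  case=> [|[->]]; first by left; left.
  by rewrite inE => /orP [/eqP ->|]; [right | left; right].
split.
- by move=> g x /KK'; apply: family_le_poly.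
- exact: (poly_family_graded inv gK').
- exact: (hilbert_basis inc adj_a gK' noethK').
Qed.

End GradedFamilies.

(** * The Artin-Rees lemma, uniformly over all degrees *)

Section ArtinRees.
Variables (R : comPzRingType) (M : lmodType R) (G : zmodType).
Variables (I : G -> R -> Prop) (F : G -> M -> Prop).
Hypotheses (noethR : noetherian_ring R).
Hypotheses (subF : graded_submodule I F) (noethF : graded_noetherian I F).

(* The Rees module of [J] lives in degrees [G * int]: the second component is
   the power of [J]. *)
Definition deg0_scalars (g : (G * int)%type) (r : R) : Prop := g.2 = 0 /\ I g.1 r.

Definition deg0_family (g : (G * int)%type) (x : M) : Prop :=
  x = 0 \/ g.2 = 0 /\ F g.1 x.

Lemma deg0_graded : graded_submodule deg0_scalars deg0_family.
Proof.
have [sF IF] := subF; split=> [g|g h r x [g2 Ir]].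
  have [F0 FD FZ] := sF g.1; split; first by left.
    move=> x y [->|[g2 Fx]]; first by rewrite add0r.
    by move=> [->|[_ Fy]]; right; rewrite ?addr0; auto.
  by move=> r x [->|[g2 Fx]]; [left; rewrite scaler0 | right; auto].
move=> [->|[h2 Fx]]; first by left; rewrite scaler0.
by right; split; [rewrite /= g2 h2 addr0 | apply: IF].
Qed.

Lemma deg0_noetherian : graded_noetherian deg0_scalars deg0_family.
Proof.
move=> S SP Sinc; pose S0 n g := S n (g, 0).
have [n|n g|N Nmax] := @noethF S0; last 1 first.
- exists N => n leNn [g z] x Sx.
  have [_ /(_ _ _ Sx)[->|[/= z0 Fx]]] := SP n.
    by case: ((SP N).1.1 (g, z)).
  by rewrite z0 in Sx *; apply: Nmax Sx.
- have [[sS IS] SF] := SP n; split; last first.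
    by move=> g x /SF [-> |[]] //; case: (subF.1 g).
  split=> [g|g h r x Ir Sx]; first exact: sS.
  by have := IS (g, 0) (h, 0) r x; rewrite /S0 -[X in (g + h, X)](addr0 0); apply.
- exact: Sinc.
Qed.

(** The constant is the index where a chain of graded submodules of the Rees module of [J] becomes
    stationary. *)
Lemma artin_rees (J : R -> Prop) (H : G -> M -> Prop) : is_ideal J ->
  graded_submodule I H -> family_le H F ->
  exists c, forall n g x, ideal_mod (ideal_pow J (c + n)) (F g) x -> H g x ->
    ideal_mod (ideal_pow J n) (H g) x.
Proof.
move=> idJ [sH IH] HF; have [sF IF] := subF.
have [s sJ Js] := ideal_fin_gen noethR idJ.
have [K [FK [sK IK] noethK]] :=
  adjoin_noetherian (0, 1) s deg0_graded deg0_noetherian.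
have idJn n := ideal_pow_ideal n idJ.
(* [K] is Noetherian and contains the Rees module, whose part in degree [(g, n)] is [J^n F g]. *)
have JK n g x : ideal_mod (ideal_pow J n) (F g) x -> K (g, n%:Z) x.
  elim: n g x => [|n IHn] g x.
    by move/(ideal_mod_sub (sF g)) => Fx; apply: FK; right.
  have [_ KD KZ] := sK (g, n.+1%:Z).
  rewrite -addn1 addnC => /ideal_mod_pow_split-/(_ idJ).
  apply: ideal_mod_min => // a y /=; rewrite addnC addn1.
  elim=> [b c Jb _ Fy||b c _ IHb _ IHc Fy].
  - rewrite mulrC -scalerA; apply: (KZ).
    (* The scalars sending [y] into [K] form an ideal, so only the generators of [J] need
       checking. *)
    apply: (Js (fun b => K (g, n.+1%:Z) (b *: y))) => // [|{Jb}b bs].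
      split=> [|p q Kp Kq|p q Kq]; first by rewrite scale0r; case: (sK (g, n.+1%:Z)).
        by rewrite scalerDl; apply: KD.
      by rewrite -scalerA; apply: (KZ).
    have := IK (0, 1) (g, n%:Z) b y; rewrite -[_ + _]/(0 + g, 1 + n%:Z) add0r -PoszD add1n.
    by apply; [right | apply: IHn].
  - by rewrite scale0r; case: (sK (g, n.+1%:Z)).
  - by rewrite scalerDl; apply: KD; auto.
(* In power [j], [S N] is [J^j F /\ H] for [j <= N], and [J^(j - N) (J^N F /\ H)] beyond: the
   submodule generated by the part of power at most [N]. The alternative [x = 0] provides for
   negative powers. *)
pose L N g x := ideal_mod (ideal_pow J N) (F g) x /\ H g x.
pose S N (g : (G * int)%type) x := x = 0 \/ exists j : nat, g.2 = j%:Z /\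
  ideal_mod (ideal_pow J (j - N)) (L (minn j N) g.1) x.
have [N|N|c cP] := noethK S.
- split; last first.
    move=> [g z] x [->|[j [/= -> Lx]]]; first by case: (sK (g, z)).
    apply: JK; rewrite -(subnK (geq_minl j N)).
    have -> : (j - minn j N = j - N)%N by lia.
    apply: ideal_mod_pow_join => //.
    by apply: ideal_mod_mono Lx => // y [].
  split=> [g|g h r x].
    split; first by left.
      move=> x y [->|[j [g2 Lx]]]; first by rewrite add0r.
      move=> [->|[j' [g2' Ly]]]; first by rewrite addr0; right; exists j.
      have {g2'} Ej : j' = j by move: g2'; rewrite g2 => -[].
      by right; exists j; split=> //; apply: im_add; rewrite // -Ej.
    move=> r x [->|[j [g2 Lx]]]; first by left; rewrite scaler0.
    right; exists j; split=> //; apply: submoduleZ Lx.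
    exact: ideal_mod_submodule.
  move=> Ir [->|[j [h2 Lx]]]; first by left; rewrite scaler0.
  right; case: Ir => [[g2 Ir]|[-> /sJ Jr]].
    exists j; split; first by rewrite /= g2 add0r.
    apply: ideal_mod_shift Lx => y [Fy Hy]; split; last exact: IH.
    by apply: ideal_mod_shift Fy => z; apply: IF.
  exists j.+1; split; first by rewrite /= h2 -[j.+1]add1n PoszD.
  rewrite /= add0r; have [ltjN|leNj] := ltnP j N.
    have -> : (j.+1 - N = j - N)%N by lia.
    have -> : minn j.+1 N = (minn j N).+1 by lia.
    apply: ideal_mod_shift Lx => y [Fy Hy]; split; last exact: submoduleZ.
    exact: ideal_mod_powS.
  have -> : minn j.+1 N = minn j N by lia.
  by rewrite subSn //; apply: ideal_mod_powS.
- move=> g x [->|[j [g2 Lx]]]; first by left.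
  right; exists j; split=> //; have [lejN|ltNj] := leqP j N.
    have -> : (j - N.+1 = j - N)%N by lia.
    by have -> : minn j N.+1 = minn j N by lia.
  have EjN : (j - N = (j - N.+1) + 1)%N by lia.
  rewrite EjN in Lx; apply: ideal_mod_mono (ideal_mod_pow_split idJ Lx) => //.
  have -> : minn j N.+1 = (1 + minn j N)%N by lia.
  move=> y Ly; split.
    by apply: ideal_mod_pow_join => //; apply: ideal_mod_mono Ly => // z [].
  by apply: (ideal_mod_sub (I := ideal_pow J 1) (sH g.1)); apply: ideal_mod_mono Ly => // z [].
exists c => n g x Fx Hx.
(* In power [c + n], the member of index [c + n] is [J^(c + n) F /\ H], while that of index [c] is
   [J^n (J^c F /\ H)]. *)
have: S (c + n)%N (g, (c + n)%N%:Z) x.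
  right; exists (c + n)%N; split=> //=; rewrite subnn minnn.
  by rewrite -[x]scale1r; apply: im_gen.
move/(cP _ (leq_addr _ _)) => [->|[j [/= [<-]]]]; first exact: im_0.
by rewrite addKn; apply: ideal_mod_mono => // y [].
Qed.

End ArtinRees.

(** * Filtration by maximal annihilators *)

Section AnnihilatorFiltration.
Variables (R : comPzRingType) (M : lmodType R) (G : zmodType).
Variables (I : G -> R -> Prop) (F : G -> M -> Prop).
Hypotheses (noethR : noetherian_ring R).
Hypotheses (subF : graded_submodule I F) (noethF : graded_noetherian I F).

(** First, [s] contains every associated prime of [F / N], up to extensional equality. Second, if
    [J'] lies in every ideal of [s] containing [J], then [J'^(size s)] sends [(N : J^oo)] into [N];
    the exponent does not depend on [J]. *)
Definition ann_cover (N : G -> M -> Prop) (s : seq (R -> Prop)) : Prop :=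
  (forall Q g x, F g x -> is_prime_ideal Q -> (forall r, Q r <-> N g (r *: x)) ->
     exists2 P, List.In P s & forall r, Q r <-> P r) /\
  forall J J', is_ideal J' ->
    (forall P, List.In P s -> is_ideal P -> (forall r, J r -> P r) ->
       forall r, J' r -> P r) ->
    forall g x, F g x -> (exists i, forall a, ideal_pow J i a -> N g (a *: x)) ->
    forall c, ideal_pow J' (size s) c -> N g (c *: x).

(* Passing from [N] to [(N : P)] with [P] a maximal annihilator modulo [N]: on
   [(N : P) / N] every nonzero element has annihilator exactly [P]. *)
Lemma ann_cover_exists N : graded_submodule I N -> family_le N F ->
  exists s, ann_cover N s.
Proof.
move=> gN NF; apply: NNPP => badN.
pose bad N := [/\ graded_submodule I N, family_le N F & ~ exists s, ann_cover N s].
(* Noetherian induction: [N] becomes a maximal counterexample. *)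
have [||{}N [{}gN {}NF {}badN] maxN] := acc_max
  (C := fun N => graded_submodule I N /\ family_le N F) (Q := bad) noethF.
- by move=> ? [].
- by exists N.
have [sN IN] := gN; have [sF IF] := subF.
pose ann g x r := N g (r *: x).
have ann_ideal g x : is_ideal (ann g x).
  have [N0 ND NZ] := sN g; split; rewrite /ann ?scale0r //.
    by move=> a b; rewrite scalerDl; apply: ND.
  by move=> r a; rewrite -scalerA; apply: NZ.
pose isann P := exists g x, [/\ F g x, ~ N g x & P = ann g x].
have [||_ [g0 [x0 [Fx0 Nx0 ->]]] maxP] :=
  acc_max (Q := isann) (le := fun P P' : R -> Prop => forall r, P r -> P' r) noethR.
- by move=> _ [g [x [_ _ ->]]].
(* Without any proper annihilator [N] equals [F], and the empty list is a cover. *)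
- apply: NNPP => noann; apply: badN; exists [::].
  have FN g x : F g x -> N g x.
    by move=> Fx; apply: NNPP => Nx; apply: noann; exists (ann g x), g, x.
  split=> [Q g x Fx [_ Q1 _] QN|J J' _ _ g x Fx _ c _].
    by case: Q1; apply/QN; rewrite scale1r; apply: FN.
  exact: FN (submoduleZ c (sF g) Fx).
set P := ann g0 x0 in maxP.
pose N' g x := F g x /\ forall r, P r -> N g (r *: x).
have annN' g x : N' g x -> ~ N g x -> forall r, N g (r *: x) -> P r.
  by case=> Fx Px Nx; apply: (maxP (ann g x)) => //; exists g, x.
have NN' : family_le N N'.
  by move=> g x Nx; split=> [|r _]; [apply: NF | apply: submoduleZ].
have gN' : graded_submodule I N'.
  split=> [g|g h r x Ir [Fx Px]].
    have [F0 FD FZ] := sF g; have [N0 ND NZ] := sN g.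
    split; first by split=> // r _; rewrite scaler0.
      move=> x y [Fx Px] [Fy Py]; split; first exact: FD.
      by move=> r Pr; rewrite scalerDr; auto.
    move=> r x [Fx Px]; split; first exact: FZ.
    by move=> q Pq; rewrite scalerA mulrC -scalerA; auto.
  split; first exact: IF.
  by move=> q Pq; rewrite scalerA mulrC -scalerA; auto.
(* [x0] lies in [N'] but not in [N], so [N'] has a cover [s]; it remains to see that [P :: s] covers
   [N]. *)
apply: (Nx0); apply: (maxN N') => //.
split=> //; first by move=> g x [].
move=> [s [sAss sCol]]; apply: badN; exists (P :: s); split.
- move=> Q g x Fx primeQ QN; have [idQ _ QM] := primeQ.
  (* If some multiple [r *: x] lies in [N'] outside [N], its annihilator is both [Q], by primality,
     and [P]. Otherwise [x] has the same annihilator modulo [N] and modulo [N']. *)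
  have [[r [N'r Nr]]|noN'] := classic (exists r, N' g (r *: x) /\ ~ N g (r *: x)).
    exists P => [|q]; first by left.
    split=> [Qq|Pq].
      by apply: (annN' g (r *: x)) => //; rewrite scalerA mulrC -scalerA;
        apply: submoduleZ => //; apply/QN.
    have: Q (q * r) by apply/QN; rewrite -scalerA; apply: N'r.2.
    by case/QM => // /QN.
  have [r|P' P's QP'] := sAss Q g x Fx primeQ; last by exists P' => //; right.
  split=> [/QN /NN' //|N'r]; apply/QN; apply: NNPP => Nr.
  by apply: noN'; exists r.
- move=> J J' idJ' JJ' g x Fx [i Ji] c /= J'c.
  suff N'N b d : J' b -> ideal_pow J' (size s) d -> N g (d *: x) \/ N g ((b * d) *: x).
    elim: J'c => [b d J'b J'd||y z _ IHy _ IHz].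
    + by case: (N'N b d) => //; rewrite -scalerA; apply: submoduleZ.
    + by rewrite scale0r; case: (sN g).
    + by rewrite scalerDl; case: (sN g) => _ ND _; apply: ND.
  move=> J'b J'd.
  have N'd : N' g (d *: x).
    apply: (sCol J J') => // [Q Qs|]; first by apply: JJ'; right.
    by exists i => a /Ji /NN'.
  (* If [J] lies in [P], so does [J'], and [b] sends [d *: x] into [N]. Otherwise some [j] of [J]
     outside [P] is injective on [N' / N], while [j ^+ i] sends [d *: x] into [N]; hence [d *: x] is
     in [N]. *)
  have [JP|] := classic (forall r, J r -> P r).
    by right; rewrite -scalerA; apply: N'd.2; apply: (JJ' P) => //; [left | apply: ann_ideal].
  move=> /not_all_ex_not [j /(imply_to_and (J j))[Jj Pj]]; left.
  have Nj : N g (j ^+ i *: (d *: x)).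
    rewrite scalerA mulrC -scalerA; apply: submoduleZ => //.
    exact/Ji/ideal_pow_expr.
  elim: {Ji} i Nj => [|i IHi]; first by rewrite scale1r.
  rewrite exprS -scalerA => Nj; apply: IHi; apply: NNPP => Ni.
  by apply/Pj/(annN' _ _ _ Ni) => //; apply: submoduleZ => //; case: gN'.
Qed.

End AnnihilatorFiltration.

(** * Finitely many hulls of ideals, and induction on nonnegative vectors *)

(** The hull of [J] is the intersection of [I0] with the ideals of [s] that contain [J]. Only
    finitely many hulls arise, so the maximum of their constants serves every [J]. In the induction
    [I0] collects the intersection made so far. *)
Lemma uniform_hull (R : comPzRingType) (s : seq (R -> Prop))
    (Phi : (R -> Prop) -> nat -> Prop) (I0 : R -> Prop) :
  (forall I k l, is_ideal I -> (k <= l)%N -> Phi I k -> Phi I l) ->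
  (forall I, is_ideal I -> exists k, Phi I k) -> is_ideal I0 ->
  exists k, forall J : R -> Prop, (forall r, J r -> I0 r) ->
    exists2 I, is_ideal I /\ Phi I k &
    [/\ forall r, J r -> I r, forall r, I r -> I0 r &
        forall P, List.In P s -> is_ideal P -> (forall r, J r -> P r) ->
          forall r, I r -> P r].
Proof.
move=> Phi_mono Phi_ex; elim: s I0 => [|P s IHs] I0 idI0.
  by have [k Phik] := Phi_ex _ idI0; exists k => J JI0; exists I0.
have [k kP] := IHs _ idI0.
have [idP|nidP] := classic (is_ideal P); last first.
  exists k => J /kP [I PhiI [JI II0 sI]]; exists I => //.
  by split=> // Q /= [<- //|]; apply: sI.
have [|l lP] := IHs (fun r => I0 r /\ P r).
  case: idI0 => I00 I0D I0M; case: idP => P0 PD PM.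
  by split=> // [a b [? ?] [? ?]|r a [? ?]]; split; auto.
exists (maxn k l) => J JI0; have [JP|nJP] := classic (forall r, J r -> P r).
  have [r Jr|I [idI PhiI] [JI II0 sI]] := lP J; first by split; auto.
  exists I; first by split=> //; apply: Phi_mono PhiI; rewrite ?leq_maxr.
  split=> // [r /II0 []|Q /= [<- _ _ r /II0 []|]] //; exact: sI.
have [I [idI PhiI] [JI II0 sI]] := kP J JI0.
exists I; first by split=> //; apply: Phi_mono PhiI; rewrite ?leq_maxl.
by split=> // Q /= [<- //|]; apply: sI.
Qed.

Lemma sum_deltaD (t : nat) (i : 'I_t) (n : 'rV[int]_t) :
  \sum_j (delta_mx 0 i + n) ord0 j = 1 + \sum_j n ord0 j.
Proof.
under eq_bigr do rewrite !mxE eqxx /=.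
rewrite big_split /=; congr (_ + _).
by rewrite (bigD1 i) //= eqxx big1 ?addr0 // => j /negbTE ->.
Qed.

Lemma nonneg_ind (t : nat) (Pr : 'rV[int]_t -> Prop) :
  Pr 0 ->
  (forall (n : 'rV[int]_t) i, (forall j, 0 <= n ord0 j) -> Pr n -> Pr (delta_mx 0 i + n)) ->
  forall n : 'rV[int]_t, (forall j, 0 <= n ord0 j) -> Pr n.
Proof.
move=> Pr0 PrD n; have [k] := ubnP (absz (\sum_(i < t) n ord0 i)).
elim: k n => // k IHk n ltk n0.
have [/existsP[i ni]|/existsPn nn] := boolP [exists i, 0 < n ord0 i]; last first.
  have -> : n = 0; last exact: Pr0.
  apply/rowP => i; rewrite mxE; apply/eqP; rewrite eq_le n0 andbT.
  by rewrite leNgt; apply: nn.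
have n'0 j : 0 <= (n - delta_mx 0 i) ord0 j.
  rewrite !mxE eqxx /=; case: eqP => [->|_]; last by rewrite subr0.
  by rewrite subr_ge0.
rewrite -[n](addrNK (delta_mx 0 i)) addrC; apply: PrD => //; apply: IHk => //.
have En := sum_deltaD i (n - delta_mx 0 i).
rewrite addrC subrK in En.
have : 0 <= \sum_j (n - delta_mx 0 i) ord0 j by apply: sumr_ge0.
by move: ltk; rewrite En; case: (\sum_j (n - delta_mx 0 i) ord0 j) => // q; rewrite -PoszD.
Qed.

(** * Unit steps of the filtration and the two conclusions *)

Section Filtration.
Variables (R : comPzRingType) (M : lmodType R) (t : nat).
Notation Zt := 'rV[int]_t.
Variables (I : Zt -> R -> Prop) (F : Zt -> M -> Prop).

(** A family becomes the set of finitely supported functions with values in it, and is recovered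
    from the functions supported in a single degree. *)
Lemma rees_graded_noetherian : (forall a, is_submodule (F a)) ->
  rees_noetherian I F -> graded_noetherian I F.
Proof.
move=> sF noeth S SP Sinc; have gS n := (SP n).1.
pose S' n (f : Zt -> M) := (exists s : seq Zt, forall a, a \notin s -> f a = 0) /\
  forall a, S n a (f a).
have [n||N Nmax] := noeth S'; last 1 first.
- exists N => n leNn g x Sx.
  have [|_ /(_ g)] := Nmax n leNn (fun b => if b == g then x else 0).
    split; first by exists [:: g] => a; rewrite inE => /negbTE ->.
    by move=> a; case: eqP => [->|_] //; case: ((gS n).1 a).
  by rewrite eqxx.
- have [sS IS] := gS n; split.
  + by move=> f [fin Sf]; split=> // a; apply: (SP n).2.
  + by split=> [|a]; [exists [::] | case: (sS a)].
  + move=> f h [[s fs] Sf] [[s' hs] Sh]; split.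
      exists (s ++ s') => a; rewrite mem_cat negb_or => /andP [/fs -> /hs ->].
      by rewrite addr0.
    by move=> a; case: (sS a) => _ SD _; apply: SD.
  + move=> g f gI [[s fs] Sf]; split.
      exists [seq p.1 + a | p <- g, a <- s] => b bs.
      rewrite /rees_act big_seq big1 // => p pg.
      rewrite fs ?scaler0 //; apply: contra bs => pbs.
      by apply/allpairsP; exists (p, b - p.1); split=> //=; rewrite addrC subrK.
    move=> b; rewrite /rees_act big_seq; have [S0 SD _] := sS b.
    apply: (big_ind (S n b)) => // p pg.
    have -> : b = p.1 + (b - p.1) by rewrite addrC subrK.
    by rewrite [X in f (X - _)]addrC subrK; apply: IS => //; apply: gI.
- by move=> n f [fin Sf]; split=> // a; apply: Sinc.
Qed.

Hypotheses (subF : graded_submodule I F) (noethF : graded_noetherian I F).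
Hypothesis I_neg : forall i : 'I_t, I (- delta_mx 0 i) 1.
Hypothesis noethR : noetherian_ring R.

Lemma filtration_le (a n : Zt) x : (forall i, 0 <= n ord0 i) -> F (a + n) x -> F a x.
Proof.
move=> n0; elim/nonneg_ind: n / n0 x => [|n i n0 IHn] x; first by rewrite addr0.
move=> Fx; apply: IHn; have := subF.2 _ _ _ _ (I_neg i) Fx.
by rewrite scale1r addrCA addKr.
Qed.

Definition step (i : 'I_t) (a : Zt) : M -> Prop := F (a + delta_mx 0 i).

Lemma step_graded i : graded_submodule I (step i).
Proof.
split=> [a|a b r x Ir Fx]; first exact: subF.1.
by rewrite /step -addrA; apply: subF.2.
Qed.

Lemma delta_ge0 (i j : 'I_t) : 0 <= (delta_mx 0 i : Zt) ord0 j.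
Proof. by rewrite mxE ler0n. Qed.

Lemma step_le i : family_le (step i) F.
Proof. by move=> a x; apply: filtration_le => j; apply: delta_ge0. Qed.

(** A longer list demands more of [J'] and concludes with a higher power of it. *)
Lemma ann_cover_incl N s s' : (forall P, List.In P s -> List.In P s') ->
  (size s <= size s')%N -> ann_cover F N s -> ann_cover F N s'.
Proof.
move=> ss' size_le [sAss sCol]; split=> [Q g x Fx primeQ QN|].
  by have [P /ss' Ps QP] := sAss Q g x Fx primeQ QN; exists P.
move=> J J' idJ' JJ' g x Fx JN c J'c.
apply: (sCol J J') => // [P /ss'|]; first exact: JJ'.
exact: ideal_pow_anti J'c.
Qed.

Lemma step_cover : exists s, forall i, ann_cover F (step i) s.
Proof.
apply: (ord_bound (join := cat) [::]) => [i s s'|i s s'|i].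
- apply: ann_cover_incl => [P Ps|]; last by rewrite size_cat leq_addr.
  by apply/List.in_or_app; left.
- apply: ann_cover_incl => [P Ps|]; last by rewrite size_cat leq_addl.
  by apply/List.in_or_app; right.
- exact: (ann_cover_exists noethR subF noethF (step_graded i) (@step_le i)).
Qed.

(** The Artin-Rees estimate for [(F (a + e_i) : J^r)], with one constant for all degrees and
    directions. Its conclusion keeps the power [J^n], so that steps can be chained. *)
Definition step_bound (r : nat) (J : R -> Prop) (k : nat) : Prop :=
  forall i n a x, ideal_mod (ideal_pow J (k + n)) (F a) x ->
    (forall c, ideal_pow J r c -> step i a (c *: x)) ->
    ideal_mod (ideal_pow J n) (step i a) x.

Lemma step_bound_le r J k l : is_ideal J -> (k <= l)%N ->
  step_bound r J k -> step_bound r J l.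
Proof.
move=> idJ lekl kP i n a x Fx; apply: kP; apply: ideal_mod_mono Fx => // c.
by apply: ideal_pow_anti => //; rewrite leq_add2r.
Qed.

Lemma step_bound_exists r J : is_ideal J -> exists k, step_bound r J k.
Proof.
move=> idJ; apply: (ord_bound (join := maxn) 0%N) => [i k l kP n a x Fx|i k l lP n a x Fx|i].
- apply: kP; apply: ideal_mod_mono Fx => // c; apply: ideal_pow_anti => //.
  by rewrite leq_add2r leq_maxl.
- apply: lP; apply: ideal_mod_mono Fx => // c; apply: ideal_pow_anti => //.
  by rewrite leq_add2r leq_maxr.
pose H a x := F a x /\ forall c, ideal_pow J r c -> step i a (c *: x).
have [sF IF] := subF; have [sS IS] := step_graded i.
have gH : graded_submodule I H.
  split=> [a|a b q x Iq [Fx Sx]].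
    have [F0 FD FZ] := sF a; have [S0 SD SZ] := sS a.
    split; first by split=> // c _; rewrite scaler0.
      move=> x y [Fx Sx] [Fy Sy]; split; first exact: FD.
      by move=> c Jc; rewrite scalerDr; auto.
    move=> q x [Fx Sx]; split; first exact: FZ.
    by move=> c Jc; rewrite scalerA mulrC -scalerA; auto.
  split; first exact: IF.
  by move=> c Jc; rewrite scalerA mulrC -scalerA; auto.
have [|c cP] := artin_rees noethR subF noethF idJ gH; first by move=> a x [].
(* Artin-Rees leaves [J^(n + r) H]; the factor [J^r] carries [H] into [F (a + e_i)]. *)
exists (c + r)%N => n a x; rewrite -addnA [(r + n)%N]addnC => Fx Sx.
have Hx : H a x by split=> //; apply: ideal_mod_sub Fx.
apply: ideal_mod_mono (ideal_mod_pow_split idJ (cP _ _ _ Fx Hx)) => // y.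
by apply: (ideal_mod_min (sS a)) => b z Jb [_]; apply.
Qed.

Lemma uniform_saturation :
  exists k : nat, forall (m n : Zt), (forall i, 0 <= n ord0 i) ->
     forall J : R -> Prop, is_ideal J -> forall x : M,
       ideal_mod (ideal_pow J (k * absz (\sum_(i < t) n ord0 i)%R)%N) (F m) x ->
       colon_inf (F (m + n)) (F m) J x -> F (m + n) x.
Proof.
have [s sP] := step_cover.
have [||//|k kP] := @uniform_hull R s (step_bound (size s)) (fun _ => True).
- by move=> J k l; apply: step_bound_le.
- by move=> J; apply: step_bound_exists.
exists k => m n n0 J idJ x JFx [_ JFmn].
have [//|J' [idJ' bnd] [JJ' _ sJ']] := kP J.
have {JFx} : ideal_mod (ideal_pow J' (k * absz (\sum_(i < t) n ord0 i))) (F m) x.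
  by apply: ideal_mod_mono JFx => // c; apply: ideal_pow_mono.
(* Each unit step spends [k] of the powers of the hull [J'], since [k (1 + |n|) = k + k |n|]; the
   saturation is still taken with respect to [J]. *)
elim/nonneg_ind: n / n0 m JFmn => [|n i n0 IHn] m JFmn J'Fx.
  by rewrite addr0; apply: ideal_mod_sub (subF.1 m) J'Fx.
rewrite addrA; apply: IHn; first by rewrite -addrA.
apply: bnd; last first.
  (* Since [F (m + e_i + n)] lies in [F (m + e_i)], a power of [J] sends [x] there; the cover turns
     it into the fixed power [size s] of [J']. *)
  apply: ((sP i).2 J J' idJ' sJ'); first exact: ideal_mod_sub (subF.1 m) J'Fx.
  have [j jP] := JFmn; exists j => a /jP; rewrite addrA; apply: filtration_le.
  exact: n0.
have : 0 <= \sum_j n ord0 j by apply: sumr_ge0.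
move: J'Fx; rewrite sum_deltaD; case: (\sum_j n ord0 j) => // q J'Fx _.
by rewrite -mulnS; apply: J'Fx.
Qed.

Lemma finite_ass : exists s : seq (R -> Prop), forall P (m n : Zt),
  (forall i, 0 <= n ord0 i) -> assoc_prime P (F m) (F (m + n)) ->
  exists2 Q, List.In Q s & forall r, P r <-> Q r.
Proof.
have [s sP] := step_cover; exists s => P m n n0 [primeP [x [Fx PF]]].
have [_ P1 PM] := primeP.
elim/nonneg_ind: n / n0 PF => [|n i n0 IHn] PF.
  by case: P1; apply/PF; rewrite scale1r addr0.
(* If a multiple of [x] lies in [F (m + n)] outside [F (m + e_i + n)], primality makes [P] its
   annihilator, so [P] is associated to the last unit step. Otherwise [P] is also the annihilator of
   [x] modulo [F (m + n)]. *)
have [[r [Fr nFr]]|noF] :=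
  classic (exists r, F (m + n) (r *: x) /\ ~ F (m + (delta_mx 0 i + n)) (r *: x)).
  apply: ((sP i).1 P (m + n) (r *: x)) => // q.
  rewrite /step -addrA [n + _]addrC scalerA -PF.
  split=> [Pq|/PM [//|/PF //]].
  by have [[_ _ PZ] _ _] := primeP; rewrite mulrC; apply: PZ.
apply: IHn => r; rewrite PF; split=> [Fr|Fr].
  by apply: (@filtration_le _ (delta_mx 0 i)) => [j|];
    rewrite ?delta_ge0 // -addrA [n + _]addrC.
by apply: NNPP => nFr; apply: noF; exists r.
Qed.

End Filtration.

Theorem theorem3p5 (R : comPzRingType) (M : lmodType R) (t : nat)
    (F : 'rV[int]_t -> M -> Prop) :
  noetherian_ring R -> fin_gen M -> noetherian_filtration F ->
  (exists k : nat, forall (m n : 'rV[int]_t), (forall i, 0 <= n ord0 i) ->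
     forall J : R -> Prop, is_ideal J ->
     forall x : M,
       ideal_mod (ideal_pow J (k * absz (\sum_(i < t) n ord0 i)%R)%N) (F m) x ->
       colon_inf (F (m + n)) (F m) J x ->
       F (m + n) x)
  /\
  (exists (s : nat) (Q : nat -> R -> Prop),
     forall (P : R -> Prop) (m n : 'rV[int]_t), (forall i, 0 <= n ord0 i) ->
       assoc_prime P (F m) (F (m + n)) ->
       exists i : nat, (i < s)%N /\ forall r, P r <-> Q i r).
Proof.
move=> noethR _ [sF [I [[idI I0 I_neg IM IF] noeth]]].
have gF : graded_submodule I F by split.
have noethF := rees_graded_noetherian sF noeth.
split; first exact: (uniform_saturation gF noethF I_neg noethR).
have [s sP] := finite_ass gF noethF I_neg noethR.
(* The default [fun=> True] is never read, as the index found is below [size s]. *)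
exists (size s), (fun i => nth (fun=> True) s i) => P m n n0 /(sP _ _ _ n0) [Q Qs PQ].
have [i [lti Ei]] : exists i, (i < size s)%N /\ nth (fun=> True) s i = Q.
  elim: s Qs {sP} => //= Q' s IHs [->|/IHs [i [lti Ei]]]; first by exists 0%N.
  by exists i.+1.
by exists i; rewrite Ei.
Qed.
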